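(* Let $0<q_1<p_1\le 1$, $0<q_2<p_2\le 1$, let $n,m\ge 1$ be integers, and let $f\in C([0,1]^2)$. Then for all $(x,y)\in[0,1]^2$, $$\left|B^{(p_1,q_1),(p_2,q_2)}_{n,m}(f;x,y)-f(x,y)\right|\le 2\,\omega(f;\delta_{n,m}),$$ where $\delta_{n,m}\ge 0$ is given by $$\delta_{n,m}^2=\frac{p_1^{n-1}}{[n]_{p_1,q_1}}(x-x^2)+\frac{p_2^{m-1}}{[m]_{p_2,q_2}}(y-y^2).$$
   Context: For $0<q<p\le 1$ and an integer $n\ge 0$, put $[n]_{p,q}=\frac{p^n-q^n}{p-q}$, $[n]_{p,q}!=[n]_{p,q}[n-1]_{p,q}\cdots[1]_{p,q}$ for $n\ge 1$, $[0]_{p,q}!=1$, and, for $0\le k\le n$, $\binom{n}{k}_{p,q}=\frac{[n]_{p,q}!}{[k]_{p,q}!\,[n-k]_{p,q}!}$. For $n\ge 1$ and $0\le k\le n$ let $$R_{n,k}(p,q;x)=p^{\frac{k(k-1)-n(n-1)}{2}}\binom{n}{k}_{p,q}x^k\prod_{s=0}^{n-k-1}(p^s-q^s x)$$ (an empty product equals $1$). For $0<q_1<p_1\le 1$, $0<q_2<p_2\le 1$, integers $n,m\ge 1$, $f:[0,1]^2\to\mathbb{R}$ and $(x,y)\in[0,1]^2$, the bivariate $(p,q)$-Bernstein operator is $$B^{(p_1,q_1),(p_2,q_2)}_{n,m}(f;x,y)=\sum_{k=0}^{n}\sum_{j=0}^{m}R_{n,k}(p_1,q_1;x)\,R_{m,j}(p_2,q_2;y)\,f\!\left(\frac{[k]_{p_1,q_1}}{[n]_{p_1,q_1}p_1^{k-n}},\frac{[j]_{p_2,q_2}}{[m]_{p_2,q_2}p_2^{j-m}}\right).$$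 $C([0,1]^2)$ is the space of continuous real-valued functions on $[0,1]^2$. For $f\in C([0,1]^2)$ and $\delta\ge 0$, the complete modulus of continuity is $$\omega(f;\delta)=\sup\left\{|f(t,s)-f(x,y)|:\ (t,s),(x,y)\in[0,1]^2,\ \sqrt{(t-x)^2+(s-y)^2}\le\delta\right\}.$$ *)

(* Defs.v *)
From HB Require Import structures.
From mathcomp Require Import all_boot all_order all_algebra.
From mathcomp Require Import all_classical all_reals all_analysis.

Set Implicit Arguments.
Unset Strict Implicit.
Unset Printing Implicit Defensive.

Import Order.TTheory GRing.Theory Num.Theory.
Import numFieldNormedType.Exports.

Local Open Scope classical_set_scope.
Local Open Scope ring_scope.

Section PQBernstein.
Variable R : realType.
Implicit Types (p q x y delta : R) (n m k j : nat) (f : R * R -> R).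

Definition pq_num p q n : R := (p ^+ n - q ^+ n) / (p - q).

Definition pq_fact p q n : R := \prod_(1 <= i < n.+1) pq_num p q i.

(* Only meant for k <= n, as n - k is truncated. *)
Definition pq_binom p q n k : R :=
  pq_fact p q n / (pq_fact p q k * pq_fact p q (n - k)).

(* The exponent of p is an integer, possibly negative; the integer division
   by 2 is exact because k(k-1) and n(n-1) are both even. *)
Definition pq_basis p q n k x : R :=
  p ^ ((k%:Z * (k%:Z - 1) - n%:Z * (n%:Z - 1)) %/ 2)%Z
  * pq_binom p q n k * x ^+ k
  * \prod_(0 <= s < n - k) (p ^+ s - q ^+ s * x).

Definition pq_node p q n k : R :=
  pq_num p q k / (pq_num p q n * p ^ (k%:Z - n%:Z)).

(* For 0 < q < p <= 1 and 1 <= n all nodes lie in [0, 1], so that only the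
   values of f on the unit square are used. *)
Definition pq_bernstein2 p1 q1 p2 q2 n m f x y : R :=
  \sum_(0 <= k < n.+1) \sum_(0 <= j < m.+1)
    pq_basis p1 q1 n k x * pq_basis p2 q2 m j y
    * f (pq_node p1 q1 n k, pq_node p2 q2 m j).

Definition unit_square : set (R * R) := `[0, 1] `*` `[0, 1].

(* sup is the real-valued supremum: for f continuous on the square and
   0 <= delta the set below is nonempty and bounded. *)
Definition modulus f delta : R :=
  sup [set d | exists u v : R * R,
    [/\ unit_square u, unit_square v,
        Num.sqrt ((u.1 - v.1) ^+ 2 + (u.2 - v.2) ^+ 2) <= delta
      & d = `|f u - f v|]].

(* For 1 <= n, m and x, y in [0, 1] the argument of the square root is
   nonnegative, so this is the nonnegative real with that square. *)
Definition pq_delta p1 q1 p2 q2 n m x y : R :=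
  Num.sqrt (p1 ^+ n.-1 / pq_num p1 q1 n * (x - x ^+ 2)
            + p2 ^+ m.-1 / pq_num p2 q2 m * (y - y ^+ 2)).

End PQBernstein.

(* Main.v *)
Require Import Defs.
From HB Require Import structures.
From mathcomp Require Import all_boot all_order all_algebra.
From mathcomp Require Import ring lra.
From mathcomp Require Import all_classical all_reals all_analysis.
Import Order.TTheory GRing.Theory Num.Theory.
Import numFieldNormedType.Exports.
Local Open Scope classical_set_scope.
Local Open Scope ring_scope.

(** Only the ratio [r = q / p] matters: powers of [p] cancel in the basis and in
    the nodes, which leaves the [q]-Bernstein operator. For it, the Pascal
    rule for Gaussian binomials gives total mass 1, and
    [[k+1] b(n+1,k+1;x) = [n+1] x b(n,k;x)] gives mean [x] and variance
    [(x - x^2) / [n]]. Hence [delta^2] is the mean squared distance of the nodes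
    to [(x, y)], and averaging
    [|f u - f v| <= (1 + |u - v|^2 / delta^2) * modulus f delta], obtained by
    subdividing the segment from [v] to [u], gives the factor 2. *)

(** * Reduction to the ratio [q / p] *)

Lemma pq_num0 (R : realType) (p q : R) : pq_num p q 0 = 0.
Proof. by rewrite /pq_num !expr0 subrr mul0r. Qed.

Lemma pq_num_gt0 (R : realType) (p q : R) (n : nat) :
  0 < q -> q < p -> (0 < n)%N -> 0 < pq_num p q n.
Proof.
move=> q0 qp n0; rewrite /pq_num divr_gt0 ?subr_gt0//.
by rewrite ltrXn2r -?lt0n// ?nnegrE ltW// (lt_trans q0).
Qed.

Lemma pq_num_scale (R : realType) (p q : R) (n : nat) : 0 < p -> q < p ->
  pq_num p q n.+1 = p ^+ n * pq_num 1 (q / p) n.+1.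
Proof.
move=> p0 qp; rewrite /pq_num expr1n expr_div_n.
have pn0 : p != 0 by rewrite gt_eqF.
have pq0 : p - q != 0 by rewrite subr_eq0 gt_eqF.
have pX : p ^+ n != 0 by rewrite expf_neq0.
rewrite !exprS; field.
by rewrite pX pn0 pq0.
Qed.

Lemma pq_factS (R : realType) (p q : R) (n : nat) :
  pq_fact p q n.+1 = pq_fact p q n * pq_num p q n.+1.
Proof. by rewrite /pq_fact big_nat_recr. Qed.

Lemma pq_fact_gt0 (R : realType) (p q : R) (n : nat) :
  0 < q -> q < p -> 0 < pq_fact p q n.
Proof.
move=> q0 qp; elim: n => [|n IHn]; first by rewrite /pq_fact big_geq.
by rewrite pq_factS mulr_gt0// pq_num_gt0.
Qed.

(** The factor of index [i] contributes [p ^+ i.-1], and these exponents add up to ['C(n, 2)]. *)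
Lemma pq_fact_scale (R : realType) (p q : R) (n : nat) : 0 < p -> q < p ->
  pq_fact p q n = p ^+ 'C(n, 2) * pq_fact 1 (q / p) n.
Proof.
move=> p0 qp; elim: n => [|n IHn].
  by rewrite /pq_fact !big_geq// expr0 mulr1.
by rewrite !pq_factS IHn pq_num_scale// binS bin1 exprD; ring.
Qed.

Lemma pq_prod_scale (R : realType) (p q x : R) (n : nat) : 0 < p ->
  \prod_(0 <= s < n) (p ^+ s - q ^+ s * x) =
  p ^+ 'C(n, 2) * \prod_(0 <= s < n) (1 - (q / p) ^+ s * x).
Proof.
move=> p0; elim: n => [|n IHn]; first by rewrite !big_geq// expr0 mulr1.
rewrite !big_nat_recr//= IHn binS bin1 exprD expr_div_n.
have pX : p ^+ n != 0 by rewrite expf_neq0// gt_eqF.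
by field.
Qed.

Lemma pq_basis1E (R : realType) (r x : R) (n k : nat) :
  pq_basis 1 r n k x =
  pq_binom 1 r n k * x ^+ k * \prod_(0 <= s < n - k) (1 - r ^+ s * x).
Proof.
rewrite /pq_basis exp1rz mul1r; congr (_ * _).
by apply: eq_bigr => s _; rewrite expr1n.
Qed.

(** Both [k(k-1)] and [n(n-1)] are twice a binomial coefficient, so the division by 2 is exact. *)
Lemma pq_basis_exponentE (R : realType) (p : R) (n k : nat) : p != 0 ->
  p ^ ((k%:Z * (k%:Z - 1) - n%:Z * (n%:Z - 1)) %/ 2)%Z =
  p ^+ 'C(k, 2) / p ^+ 'C(n, 2).
Proof.
move=> p0.
have binz (i : nat) : (i%:Z * (i%:Z - 1) = 'C(i, 2)%:Z * 2)%R.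
  elim: i => [|i IHi]; first by rewrite mul0r.
  rewrite binS bin1 PoszD mulrDl -IHi -addn1 PoszD; ring.
by rewrite !binz -mulrBl mulzK// expfzDr// -exprnN.
Qed.

(** The exponents of [p] cancel: ['C(k, 2) - 'C(n, 2)] from the prefactor,
    ['C(n, 2) - 'C(k, 2) - 'C(n - k, 2)] from the binomial and ['C(n - k, 2)] from the product. *)
Lemma pq_basis_scale (R : realType) (p q x : R) (n k : nat) :
  0 < q -> q < p -> (k <= n)%N ->
  pq_basis p q n k x = pq_basis 1 (q / p) n k x.
Proof.
move=> q0 qp kn; have p0 := lt_trans q0 qp.
have r0 : 0 < q / p by rewrite divr_gt0.
have r1 : q / p < 1 by rewrite ltr_pdivrMr// mul1r.
rewrite pq_basis1E /pq_basis pq_basis_exponentE ?gt_eqF// pq_prod_scale//.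
rewrite /pq_binom !(@pq_fact_scale _ p q)//.
have pX i : p ^+ i != 0 by rewrite expf_neq0// gt_eqF.
have fX i : pq_fact 1 (q / p) i != 0 by rewrite gt_eqF// pq_fact_gt0.
by field; rewrite !pX !fX.
Qed.

Lemma pq_node_scale (R : realType) (p q : R) (n k : nat) :
  0 < q -> q < p -> (0 < n)%N ->
  pq_node p q n k = pq_num 1 (q / p) k / pq_num 1 (q / p) n.
Proof.
move=> q0 qp; have p0 := lt_trans q0 qp.
have r0 : 0 < q / p by rewrite divr_gt0.
have r1 : q / p < 1 by rewrite ltr_pdivrMr// mul1r.
case: n => // n _; rewrite /pq_node.
(* [pq_num_scale] covers successors only; at [k = 0] both sides vanish. *)
case: k => [|k]; first by rewrite !pq_num0 !mul0r.
have pX i : p ^+ i != 0 by rewrite expf_neq0// gt_eqF.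
have -> : p ^ (k.+1%:Z - n.+1%:Z) = p ^+ k / p ^+ n.
  rewrite -[k.+1]add1n -[n.+1]add1n !PoszD opprD addrACA subrr add0r.
  by rewrite expfzDr ?gt_eqF// -exprnN.
rewrite !(@pq_num_scale _ p q)//.
have := @pq_num_gt0 _ _ _ n.+1 r0 r1 isT => /lt0r_neq0 nn0.
by field; rewrite !pX nn0.
Qed.

(** * Total mass, mean and variance of the basis for [p = 1], [q = r] *)

Section QBernstein.
Variables (R : realType) (r : R).
Hypotheses (r0 : 0 < r) (r1 : r < 1).
Implicit Types (x : R) (n k : nat).

Let num := pq_num 1 r.
Let b n k x := pq_basis 1 r n k x.

Let fact_neq0 n : pq_fact 1 r n != 0.
Proof. by rewrite gt_eqF// pq_fact_gt0. Qed.

Let num_neq0 n : num n.+1 != 0.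
Proof. by rewrite gt_eqF// pq_num_gt0. Qed.

Lemma q_numS n : num n.+1 = 1 + r * num n.
Proof.
rewrite /num /pq_num !expr1n exprS.
by field; rewrite subr_eq0 gt_eqF.
Qed.

Lemma q_num_le1 n k : (0 < n)%N -> (k <= n)%N -> 0 <= num k / num n <= 1.
Proof.
move=> n0 kn; have n1 : 0 < num n by exact: pq_num_gt0.
rewrite divr_ge0 ?(ltW n1)//=; last first.
  by case: k {kn} => [|k]; [rewrite /num pq_num0 | exact/ltW/pq_num_gt0].
rewrite ler_pdivrMr// mul1r /num /pq_num !expr1n ler_pM2r ?invr_gt0 ?subr_gt0//.
by rewrite lerD2l lerN2 ler_wiXn2l// ltW.
Qed.

(** Split the last factor of [[n+1]!] as [[n+1] = r^(k+1) [n-k] + [k+1]]; each summand cancels one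
    factor of the denominator. *)
Lemma q_binom_pascal n k : (k < n)%N ->
  pq_binom 1 r n.+1 k.+1 = r ^+ k.+1 * pq_binom 1 r n k.+1 + pq_binom 1 r n k.
Proof.
move=> kn; rewrite /pq_binom subSS.
have -> : (n - k = (n - k.+1).+1)%N by rewrite subnSK.
have numD : num n.+1 = r ^+ k.+1 * num (n - k.+1).+1 + num k.+1.
  rewrite /num /pq_num !expr1n subnSK//.
  have -> : n.+1 = (k.+1 + (n - k))%N by rewrite addSn subnKC// ltnW.
  by rewrite exprD; field; rewrite subr_eq0 gt_eqF.
rewrite !pq_factS -!/num numD.
by field; rewrite !fact_neq0 !num_neq0.
Qed.

Lemma q_binomn0 n : pq_binom 1 r n 0 = 1.
Proof.
by rewrite /pq_binom subn0 {2}/pq_fact big_geq// mul1r divff.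
Qed.

Lemma q_binomnn n : pq_binom 1 r n n = 1.
Proof.
by rewrite /pq_binom subnn {3}/pq_fact big_geq// mulr1 divff.
Qed.

Lemma q_prodS x n : \prod_(0 <= s < n.+1) (1 - r ^+ s * x) =
  (1 - x) * \prod_(0 <= s < n) (1 - r ^+ s * (r * x)).
Proof.
rewrite big_nat_recl// expr0 mul1r; congr (_ * _).
by apply: eq_bigr => s _; rewrite exprSr mulrA.
Qed.

(** In the Pascal rule, [r ^+ k.+1] merges with [x ^+ k.+1] into a power of [r * x], and splitting
    [1 - x] off the product leaves a product at [r * x]. *)
Lemma q_basis_recur n k x : (k < n)%N ->
  b n.+1 k.+1 x = (1 - x) * b n k.+1 (r * x) + x * b n k x.
Proof.
move=> kn; rewrite /b !pq_basis1E q_binom_pascal// subSS.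
rewrite -(subnSK kn) mulrDl mulrDl; congr (_ + _); last by rewrite exprS; ring.
by rewrite q_prodS exprMn; ring.
Qed.

(** Induction for all [x] at once, since the recursion also evaluates at [r * x]; the total is
    [(1 - x) + x]. *)
Lemma q_basis_sum n x : \sum_(0 <= k < n.+1) b n k x = 1.
Proof.
elim: n x => [|n IHn] x.
  by rewrite big_nat1 /b pq_basis1E q_binomn0 expr0 big_geq// !mulr1.
rewrite big_nat_recl// big_nat_recr//=.
rewrite (eq_big_nat _ _ (F2 := fun k => (1 - x) * b n k.+1 (r * x) + x * b n k x));
  last by move=> k /andP[_ kn]; exact: q_basis_recur.
rewrite big_split/= -!mulr_sumr.
have -> : b n.+1 0 x = (1 - x) * b n 0 (r * x).
  by rewrite /b !pq_basis1E !q_binomn0 !expr0 !subn0 q_prodS; ring.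
have -> : b n.+1 n.+1 x = x * b n n x.
  by rewrite /b !pq_basis1E !q_binomnn !subnn !big_geq// exprS; ring.
(* The sum at [r * x] lacks its first term and the sum at [x] its last; the two end terms supply
   them. *)
have /esym/eqP := IHn (r * x); rewrite big_nat_recl// -subr_eq => /eqP <-.
have /esym/eqP := IHn x; rewrite big_nat_recr//= -subr_eq => /eqP <-.
ring.
Qed.

Lemma q_basis_absorb n k x : (k <= n)%N ->
  num k.+1 * b n.+1 k.+1 x = num n.+1 * x * b n k x.
Proof.
move=> kn; rewrite /b !pq_basis1E subSS exprS /pq_binom subSS !pq_factS -!/num.
by field; rewrite !fact_neq0 num_neq0.
Qed.

(** The factor [num k] kills the term [k = 0], and absorption lowers the degree of the others.
    Taking [g] constant or [num] gives the first two moments. *)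
Lemma q_basis_moment n x (g : nat -> R) :
  \sum_(0 <= k < n.+2) num k * g k * b n.+1 k x =
  num n.+1 * x * \sum_(0 <= k < n.+1) g k.+1 * b n k x.
Proof.
rewrite big_nat_recl// {1}/num pq_num0 !mul0r add0r mulr_sumr.
apply: eq_big_nat => k /andP[_ kn].
by rewrite mulrAC q_basis_absorb//; ring.
Qed.

Lemma q_basis_moment1 n x : (0 < n)%N ->
  \sum_(0 <= k < n.+1) num k * b n k x = num n * x.
Proof.
case: n => // n _; have := q_basis_moment n x (fun=> 1).
under eq_bigr do rewrite mulr1.
by under [in RHS]eq_bigr do rewrite mul1r; rewrite q_basis_sum mulr1.
Qed.

Lemma q_basis_moment2 n x : (0 < n)%N ->
  \sum_(0 <= k < n.+1) num k * num k * b n k x =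
  num n * x * (1 + (num n - 1) * x).
Proof.
case: n => // n _; rewrite q_basis_moment q_numS; congr (_ * _).
(* [[k+1] = 1 + r [k]] reduces the sum to the mass and the mean in degree [n]. *)
under eq_bigr do rewrite q_numS mulrDl mul1r.
rewrite big_split/= q_basis_sum; congr (_ + _).
under eq_bigr do rewrite -mulrA.
rewrite -mulr_sumr [1 + _]addrC addrK.
(* [q_basis_moment1] needs positive degree; in degree 0 only the term with [num 0 = 0] occurs. *)
case: n => [|n]; first by rewrite big_nat1 /num pq_num0; ring.
by rewrite q_basis_moment1// mulrA.
Qed.

Lemma q_basis_variance n x : (0 < n)%N ->
  \sum_(0 <= k < n.+1) b n k x * (num k / num n - x) ^+ 2 =
  (num n)^-1 * (x - x ^+ 2).
Proof.
move=> n0; have nn0 : num n != 0 by rewrite -(prednK n0).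
rewrite (eq_bigr (fun k => (num n)^-2 * (num k * num k * b n k x)
    + ((- (2 * x / num n)) * (num k * b n k x) + x ^+ 2 * b n k x))); last first.
  by move=> k _; field.
rewrite !big_split/= -!mulr_sumr q_basis_moment1// q_basis_moment2//.
by rewrite q_basis_sum; field.
Qed.

Lemma q_basis_ge0 n k x : 0 <= x <= 1 -> 0 <= b n k x.
Proof.
move=> /andP[x0 x1]; rewrite /b pq_basis1E mulr_ge0//.
  rewrite mulr_ge0 ?exprn_ge0// /pq_binom divr_ge0 ?mulr_ge0//;
  by rewrite ltW// pq_fact_gt0.
rewrite prodr_ge0// => s _; rewrite subr_ge0 mulr_ile1 ?exprn_ge0 ?(ltW r0)//.
by rewrite exprn_ile1// ltW.
Qed.

End QBernstein.

(** * Transfer of the moments back to [p] and [q] *)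

Section PQBernsteinMoments.
Variables (R : realType) (p q : R).
Hypotheses (q0 : 0 < q) (qp : q < p).
Implicit Types (x : R) (n k : nat).

Let p0 : 0 < p := lt_trans q0 qp.
Let r0 : 0 < q / p. Proof. by rewrite divr_gt0. Qed.
Let r1 : q / p < 1. Proof. by rewrite ltr_pdivrMr// mul1r. Qed.

Lemma pq_basis_ge0 n k x : (k <= n)%N -> 0 <= x <= 1 -> 0 <= pq_basis p q n k x.
Proof. by move=> kn x01; rewrite pq_basis_scale// q_basis_ge0. Qed.

Lemma pq_node_itv n k : (0 < n)%N -> (k <= n)%N -> 0 <= pq_node p q n k <= 1.
Proof. by move=> n0 kn; rewrite pq_node_scale// q_num_le1. Qed.

Lemma pq_basis_sum n x : \sum_(k < n.+1) pq_basis p q n k x = 1.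
Proof.
rewrite -(@q_basis_sum _ _ r0 r1 n x) big_mkord.
by apply: eq_bigr => k _; rewrite pq_basis_scale// -ltnS.
Qed.

Lemma pq_basis_variance n x : (0 < n)%N ->
  \sum_(k < n.+1) pq_basis p q n k x * (pq_node p q n k - x) ^+ 2 =
  p ^+ n.-1 / pq_num p q n * (x - x ^+ 2).
Proof.
move=> n0; have -> : p ^+ n.-1 / pq_num p q n = (pq_num 1 (q / p) n)^-1.
  rewrite -(prednK n0) pq_num_scale//= invfM mulrA divff ?mul1r//.
  by rewrite expf_neq0// gt_eqF.
rewrite -q_basis_variance// big_mkord; apply: eq_bigr => k _.
have kn : (k <= n)%N by rewrite -ltnS.
by rewrite pq_basis_scale// pq_node_scale.
Qed.

End PQBernsteinMoments.

(** * Modulus of continuity and weighted means *)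

Lemma unit_squareE (R : realType) (u : R * R) :
  unit_square u <-> 0 <= u.1 <= 1 /\ 0 <= u.2 <= 1.
Proof. by rewrite /unit_square /setX /= !in_itv. Qed.

Section Modulus.
Variables (R : realType) (f : R * R -> R).
Hypothesis hf : {within @unit_square R, continuous f}.
Implicit Types (u v : R * R) (delta : R).

Let sqdist u v := (u.1 - v.1) ^+ 2 + (u.2 - v.2) ^+ 2.

Let sqdist_ge0 u v : 0 <= sqdist u v.
Proof. by rewrite addr_ge0 ?sqr_ge0. Qed.

(** [f] is bounded on the compact square; [sup] is known to dominate its set only once the set is
    bounded. *)
Lemma modulus_has_ubound delta : has_ubound [set d | exists u v : R * R,
    [/\ unit_square u, unit_square v,
        Num.sqrt ((u.1 - v.1) ^+ 2 + (u.2 - v.2) ^+ 2) <= delta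
      & d = `|f u - f v|]].
Proof.
have /compact_bounded[M [Mreal fM]] : compact (f @` @unit_square R).
  apply: continuous_compact => //.
  by apply: compact_setX; exact: segment_compact.
have fM1 u : unit_square u -> `|f u| <= M + 1.
  by move=> su; apply: (fM (M + 1)); [rewrite ltrDl | exists u].
exists ((M + 1) + (M + 1)) => _ [u [v [su sv _ ->]]].
by rewrite (le_trans (ler_normB _ _))// lerD// fM1.
Qed.

Lemma le_modulus delta u v : unit_square u -> unit_square v ->
  sqdist u v <= delta ^+ 2 -> 0 <= delta -> `|f u - f v| <= modulus f delta.
Proof.
move=> su sv uv d0; apply: ub_le_sup; first exact: modulus_has_ubound.
exists u, v; split => //.
by rewrite -[leRHS](ger0_norm d0) -sqrtr_sqr ler_wsqrtr.
Qed.

Lemma modulus_ge0 delta : 0 <= delta -> 0 <= modulus f delta.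
Proof.
move=> d0; have s0 : @unit_square R (0, 0).
  by apply/unit_squareE; rewrite /= lexx ler01.
apply: (le_trans (normr_ge0 (f (0, 0) - f (0, 0)))); apply: le_modulus => //.
by rewrite /sqdist !subrr expr0n addr0 sqr_ge0.
Qed.

(* Cut the segment from v to u into N.+1 equal pieces of length at most delta. *)
Lemma le_modulus_mulrn delta u v (N : nat) :
  unit_square u -> unit_square v -> 0 <= delta ->
  sqdist u v <= (N.+1%:R * delta) ^+ 2 ->
  `|f u - f v| <= N.+1%:R * modulus f delta.
Proof.
move=> su sv d0 uv.
pose w (i : nat) : R * R :=
  (v.1 + i%:R / N.+1%:R * (u.1 - v.1), v.2 + i%:R / N.+1%:R * (u.2 - v.2)).
have N0 : 0 < N.+1%:R :> R by rewrite ltr0n.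
have wN : w N.+1 = u.
  by case: u {su uv} @w => a b /=; rewrite divff ?gt_eqF// !mul1r !subrKC.
have w0 : w 0 = v.
  by case: v {sv uv wN} @w => a b /=; rewrite !mul0r !addr0.
have sw i : (i <= N.+1)%N -> unit_square (w i).
  move=> iN.
  have t1 : i%:R / N.+1%:R <= 1 :> R by rewrite ler_pdivrMr// mul1r ler_nat.
  have t0 : 0 <= i%:R / N.+1%:R :> R by rewrite divr_ge0.
  move/unit_squareE : su => [/andP[? ?] /andP[? ?]].
  move/unit_squareE : sv => [/andP[? ?] /andP[? ?]].
  apply/unit_squareE => /=; move: (i%:R / N.+1%:R) t0 t1 => t t0 t1.
  by split; apply/andP; split; nra.
rewrite -wN -w0 -(telescope_sumr (fun i => f (w i)))//.
rewrite (le_trans (ler_norm_sum _ _ _))//.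
rewrite [leRHS]mulr_natl -[X in _ *+ X]subn0 -[leRHS]sumr_const_nat.
rewrite big_nat [leRHS]big_nat ler_sum// => i /andP[_ iN].
apply: le_modulus => //; try (by apply: sw; rewrite // ltnW).
(* Consecutive points differ by [(u - v) / N.+1]. *)
have -> : sqdist (w i.+1) (w i) = sqdist u v / N.+1%:R ^+ 2.
  rewrite /sqdist /w /= -(natr1 i); field.
  by rewrite ?[1 + _]addrC ?natr1 gt_eqF.
by rewrite ler_pdivrMr ?exprn_gt0// mulrC -exprMn.
Qed.

(** Let [t = |u - v| / delta]. For [t <= 1] the definition of the modulus suffices; for [t > 1] use
    [floor t + 1] pieces and [floor t <= t <= t ^+ 2]. *)
Lemma le_modulus_sqdist delta u v :
  unit_square u -> unit_square v -> 0 < delta ->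
  `|f u - f v| <= (1 + sqdist u v / delta ^+ 2) * modulus f delta.
Proof.
move=> su sv d0; have w0 := modulus_ge0 _ (ltW d0).
have [uv|uv] := leP (sqdist u v) (delta ^+ 2).
  rewrite (le_trans (le_modulus _ _ _ su sv uv (ltW d0)))// ler_peMl// lerDl.
  by rewrite divr_ge0 ?sqr_ge0.
set d := Num.sqrt (sqdist u v).
have dE : sqdist u v = d ^+ 2 by rewrite sqr_sqrtr.
have dd : 1 <= d / delta.
  rewrite ler_pdivlMr// mul1r -(ler_sqr) ?nnegrE ?sqrtr_ge0 ?(ltW d0)//.
  by rewrite -dE ltW.
have /truncn_itv/andP[N1 N2] : 0 <= d / delta by rewrite (le_trans _ dd).
apply: le_trans (le_modulus_mulrn _ _ _ (Num.truncn (d / delta)) su sv (ltW d0) _) _.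
  rewrite dE ler_sqr ?nnegrE ?sqrtr_ge0 ?mulr_ge0 ?(ltW d0)//.
  by rewrite -ler_pdivrMr// ltW.
rewrite ler_wpM2r// -natr1 addrC lerD2l (le_trans N1)// dE -expr_div_n.
by rewrite expr2 ler_peMl// (le_trans _ dd).
Qed.

(** The weights form a probability distribution with mean squared distance [delta ^+ 2] to [v]; for
    [delta > 0], averaging [le_modulus_sqdist] gives the factor
    [1 + delta ^+ 2 / delta ^+ 2 = 2]. *)
Lemma weighted_mean_le_modulus (I : finType) (a : I -> R) (z : I -> R * R)
    delta v :
  (forall i, 0 <= a i) -> \sum_i a i = 1 ->
  (forall i, unit_square (z i)) -> unit_square v -> 0 <= delta ->
  \sum_i a i * ((z i).1 - v.1) ^+ 2 + \sum_i a i * ((z i).2 - v.2) ^+ 2 =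
    delta ^+ 2 ->
  `|\sum_i a i * f (z i) - f v| <= 2 * modulus f delta.
Proof.
move=> a0 a1 sz sv d0 var; have w0 := modulus_ge0 _ d0.
have -> : \sum_i a i * f (z i) - f v = \sum_i a i * (f (z i) - f v).
  by under [RHS]eq_bigr do rewrite mulrBr; rewrite sumrB -mulr_suml a1 mul1r.
have {}var : \sum_i a i * sqdist (z i) v = delta ^+ 2.
  by rewrite -var -big_split/=; apply: eq_bigr => i _; rewrite mulrDr.
have ad0 i : 0 <= a i * sqdist (z i) v by rewrite mulr_ge0.
have [dE|dn0] := eqVneq delta 0.
  (* [le_modulus_sqdist] would divide by 0; instead, every point of positive
     weight equals [v]. *)
  rewrite big1 ?normr0 ?mulr_ge0// => i _.
  move: var; rewrite dE expr0n/= => /psumr_eq0P/(_ i isT) => /(_ (fun i _ => ad0 i))/eqP.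
  rewrite mulf_eq0 => /orP[/eqP->|]; first by rewrite mul0r.
  rewrite paddr_eq0 ?sqr_ge0// !sqrf_eq0 !subr_eq0 => /andP[/eqP e1 /eqP e2].
  have -> : z i = v by case: (z i) (v) e1 e2 => ? ? [? ?] /= -> ->.
  by rewrite subrr mulr0.
have dp : 0 < delta by rewrite lt_def dn0.
rewrite (le_trans (ler_norm_sum _ _ _))//.
apply: (@le_trans _ _ (\sum_i (a i + a i * sqdist (z i) v / delta ^+ 2) * modulus f delta)).
  apply: ler_sum => i _; rewrite normrM ger0_norm//.
  rewrite (_ : _ * modulus _ _ = a i *
    ((1 + sqdist (z i) v / delta ^+ 2) * modulus f delta)); last by ring.
  by rewrite ler_wpM2l// le_modulus_sqdist.
by rewrite -mulr_suml big_split/= -mulr_suml a1 var divff ?expf_neq0.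
Qed.

End Modulus.

(** * Product weights and the bivariate estimate *)

Lemma sum_pair_mul (R : comNzRingType) (I J : finType) (a : I -> R) (b : J -> R) :
  \sum_(ij : I * J) a ij.1 * b ij.2 = (\sum_i a i) * (\sum_j b j).
Proof.
rewrite -(pair_big xpredT xpredT (fun i j => a i * b j))/= mulr_suml.
by apply: eq_bigr => i _; rewrite mulr_sumr.
Qed.

Theorem theorem3p1 (R : realType) (p1 q1 p2 q2 : R) (n m : nat)
    (f : R * R -> R)
    (hq1 : 0 < q1) (hqp1 : q1 < p1) (hp1 : p1 <= 1)
    (hq2 : 0 < q2) (hqp2 : q2 < p2) (hp2 : p2 <= 1)
    (hn : (1 <= n)%N) (hm : (1 <= m)%N)
    (hf : {within @unit_square R, continuous f}) :
  forall x y : R, 0 <= x <= 1 -> 0 <= y <= 1 ->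
    `|pq_bernstein2 p1 q1 p2 q2 n m f x y - f (x, y)|
      <= 2 * modulus f (pq_delta p1 q1 p2 q2 n m x y).
Proof.
move=> x y x01 y01.
pose a (i : 'I_n.+1 * 'I_m.+1) :=
  pq_basis p1 q1 n i.1 x * pq_basis p2 q2 m i.2 y.
pose z (i : 'I_n.+1 * 'I_m.+1) := (pq_node p1 q1 n i.1, pq_node p2 q2 m i.2).
have le_ord k (i : 'I_k.+1) : (i <= k)%N by rewrite -ltnS.
have -> : pq_bernstein2 p1 q1 p2 q2 n m f x y = \sum_i a i * f (z i).
  rewrite /pq_bernstein2 big_mkord.
  under eq_bigr do rewrite big_mkord.
  by rewrite pair_bigA.
have var1 := pq_basis_variance _ _ _ hq1 hqp1 n x hn.
have var2 := pq_basis_variance _ _ _ hq2 hqp2 m y hm.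
apply: weighted_mean_le_modulus => //.
- by move=> i; rewrite mulr_ge0// pq_basis_ge0.
- rewrite (sum_pair_mul _ _ _ (fun i : 'I_n.+1 => pq_basis p1 q1 n i x)
    (fun j : 'I_m.+1 => pq_basis p2 q2 m j y)).
  by rewrite !pq_basis_sum// mulr1.
- by move=> i; apply/unit_squareE; rewrite /= !pq_node_itv.
- exact: sqrtr_ge0.
(* Rewritten as a sum of two variances, the argument of the square root is visibly nonnegative. *)
rewrite sqr_sqrtr -var1 -var2; last first.
  by rewrite addr_ge0// sumr_ge0// => i _; rewrite mulr_ge0 ?sqr_ge0 ?pq_basis_ge0.
(* Each squared coordinate difference involves one index only, and the weights of the other index
   sum to 1. *)
congr (_ + _) => /=.
- rewrite (eq_bigr (fun i : 'I_n.+1 * 'I_m.+1 =>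
    pq_basis p1 q1 n i.1 x * (pq_node p1 q1 n i.1 - x) ^+ 2 *
    pq_basis p2 q2 m i.2 y)); last by move=> i _; rewrite mulrAC.
  rewrite (sum_pair_mul _ _ _ (fun i : 'I_n.+1 =>
      pq_basis p1 q1 n i x * (pq_node p1 q1 n i - x) ^+ 2)
    (fun j : 'I_m.+1 => pq_basis p2 q2 m j y)).
  by rewrite pq_basis_sum// mulr1.
- rewrite (eq_bigr (fun i : 'I_n.+1 * 'I_m.+1 => pq_basis p1 q1 n i.1 x *
    (pq_basis p2 q2 m i.2 y * (pq_node p2 q2 m i.2 - y) ^+ 2)));
    last by move=> i _; rewrite mulrA.
  rewrite (sum_pair_mul _ _ _ (fun i : 'I_n.+1 => pq_basis p1 q1 n i x)
    (fun j : 'I_m.+1 => pq_basis p2 q2 m j y * (pq_node p2 q2 m j - y) ^+ 2)).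
  by rewrite pq_basis_sum// mul1r.
Qed.
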